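(* For all $r\in\mathbb{N}$ and $m_1,\ldots,m_r\in\mathbb{N}$ with $m=\operatorname{lcm}(m_1,\ldots,m_r)$, $$R(m_1,\ldots,m_r):=\sum_{\substack{k=1\\ \gcd(k,m)=1}}^m c_{m_1}(k-1)\cdots c_{m_r}(k-1)=\phi(m)\sum_{d_1\mid m_1,\ldots,d_r\mid m_r}\frac{d_1\mu(m_1/d_1)\cdots d_r\mu(m_r/d_r)}{\phi(\operatorname{lcm}(d_1,\ldots,d_r))}.$$
   Context: For $n\in\mathbb{N}$ and $k\in\mathbb{Z}$, $c_n(k)=\sum_{1\le j\le n,\ \gcd(j,n)=1}\exp(2\pi i jk/n)$ is the Ramanujan sum. $\mu$ is the Möbius function, $\phi$ Euler's totient. *)

(* Defs.v *)
From mathcomp Require Import all_boot all_order all_algebra.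
From mathcomp Require Import complex.
From mathcomp Require Import reals sequences exp trigo.

Set Implicit Arguments.
Unset Strict Implicit.
Unset Printing Implicit Defensive.

Import GRing.Theory Num.Theory.

Local Open Scope ring_scope.
Local Open Scope complex_scope.

Definition cexp (R : realType) (z : R[i]) : R[i] :=
  (expR (complex.Re z))%:C * (cos (complex.Im z) +i* sin (complex.Im z)).

Definition ramanujan_sum (R : realType) (n : nat) (k : int) : R[i] :=
  \sum_(1 <= j < n.+1 | coprime j n)
    cexp (2 * (@pi R)%:C * 'i%C * j%:R * k%:~R / n%:R).

(* The value at 0, outside the domain of the Moebius function, is 0. *)
Definition moebius (n : nat) : int :=
  if (0 < n)%N && all (fun p => logn p n == 1%N) (primes n)
  then (-1) ^+ size (primes n) else 0.

Definition lcm_family (r : nat) (m : 'I_r -> nat) : nat :=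
  \big[lcmn/1%N]_(i < r) m i.

Definition ramanujan_R (R : realType) (r : nat) (m : 'I_r -> nat) : R[i] :=
  \sum_(1 <= k < (lcm_family m).+1 | coprime k (lcm_family m))
    \prod_(i < r) ramanujan_sum R (m i) (k%:Z - 1).

(* For positive m_i every divisor of m_i is at most lcm(m_1, ..., m_r), so the
   divisor tuples are the functions into 'I_(lcm_family m).+1 selected below. *)
Definition divisor_tuple (r : nat) (m : 'I_r -> nat)
    (d : {ffun 'I_r -> 'I_(lcm_family m).+1}) : bool :=
  [forall i, (d i %| m i)%N].

(* Main.v *)
(* Detecting coprimality by sum_(d | gcd (j, n)) mu d and summing the geometric
   series of roots of unity gives c_n(k) = sum_(e | n, e | k) e mu(n/e).
   Expanding the product, the tuple d contributes prod_i d_i mu(m_i/d_i) times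
   the number of units k mod m with k = 1 mod L, L := lcm(d_1, ..., d_r).
   Units mod L lift to units mod m, so multiplication by a lift shows that all
   fibres of (Z/m)^* -> (Z/L)^* have the same cardinal, phi(m) / phi(L). *)
Require Import Defs.
From mathcomp Require Import all_boot all_order all_algebra.
From mathcomp Require Import complex.
From mathcomp Require Import reals sequences exp trigo.

Set Implicit Arguments.
Unset Strict Implicit.
Unset Printing Implicit Defensive.

Import Order.TTheory GRing.Theory Num.Theory.

Local Open Scope ring_scope.

(** * Divisor sums of the Moebius function, and sums over multiples *)

Lemma moebius_mul_prime (p d : nat) :
  prime p -> (0 < d)%N -> ~~ (p %| d)%N -> moebius (p * d) = - moebius d.
Proof.
move=> p_pr d_gt0 pNd; have p_gt0 := prime_gt0 p_pr.
have pNpr : p \notin primes d by rewrite mem_primes p_pr d_gt0.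
have perm_pd : perm_eq (primes (p * d)) (p :: primes d).
  apply: uniq_perm; rewrite ?primes_uniq //= ?pNpr ?primes_uniq // => q.
  by rewrite primesM // in_cons primes_prime // inE.
rewrite /moebius muln_gt0 p_gt0 d_gt0 /= (perm_size perm_pd) (perm_all _ perm_pd).
rewrite /= lognM // logn_prime // eqxx lognE (negPf pNd) !andbF addn0 /=.
have -> : all (fun q => logn q (p * d) == 1%N) (primes d) =
          all (fun q => logn q d == 1%N) (primes d).
  apply: eq_in_all => q q_d; rewrite lognM // logn_prime //.
  by have [eq_qp|] := eqVneq q p; first by rewrite -eq_qp q_d in pNpr.
by case: ifP => _; rewrite ?oppr0 // exprS mulN1r.
Qed.

Lemma moebius_sqr_dvd (p d : nat) :
  prime p -> (p %| d)%N -> moebius (p * d) = 0.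
Proof.
(* The case [d = 0] is included; there the default value of [moebius] gives 0. *)
move=> p_pr p_d; rewrite /moebius; case: posnP => //= pd_gt0.
have /andP[p_gt0 d_gt0] : (0 < p)%N && (0 < d)%N by rewrite -muln_gt0.
case: ifP => // /allP/(_ p); rewrite mem_primes p_pr pd_gt0 dvdn_mulr //.
move=> /(_ isT); rewrite lognM // logn_prime // eqxx.
by rewrite lognE p_pr d_gt0 p_d.
Qed.

(* For a prime p dividing n, the divisors d and p d of n, with d prime to p,
   contribute opposite terms, and all other divisors contribute 0. *)
Lemma sum_moebius_divisors (n : nat) :
  (0 < n)%N -> \sum_(d <- divisors n) moebius d = (n == 1%N)%:R.
Proof.
move=> n_gt0; have [->|n_neq1] := eqVneq n 1%N; first by rewrite big_seq1.
have n_gt1 : (1 < n)%N by case: n n_gt0 n_neq1 => [|[]].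
have := pdiv_prime n_gt1; have := pdiv_dvd n; move: (pdiv n) => p p_n p_pr.
have p_gt0 := prime_gt0 p_pr.
have np_gt0 : (0 < n %/ p)%N by rewrite divn_gt0 // dvdn_leq.
rewrite (bigID (dvdn p)) /=.
have perm_p : perm_eq [seq d <- divisors n | (p %| d)%N]
                      [seq (p * d)%N | d <- divisors (n %/ p)].
  apply: uniq_perm.
  - by rewrite filter_uniq // divisors_uniq.
  - rewrite map_inj_uniq ?divisors_uniq // => x y /eqP.
    by rewrite eqn_pmul2l // => /eqP.
  move=> d; rewrite mem_filter -dvdn_divisors //.
  apply/andP/mapP => [[/dvdnP[e ->]]|[e]].
    rewrite mulnC => pe_n; exists e => //.
    by rewrite -dvdn_divisors // dvdn_divRL // mulnC.
  rewrite -dvdn_divisors // dvdn_divRL // => pe_n ->.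
  by rewrite dvdn_mulr // mulnC.
rewrite -big_filter (perm_big _ perm_p) big_map.
rewrite (bigID (dvdn p)) /= big1 ?add0r; last by move=> d; exact: moebius_sqr_dvd.
have perm_q : perm_eq [seq d <- divisors (n %/ p) | ~~ (p %| d)%N]
                      [seq d <- divisors n | ~~ (p %| d)%N].
  apply: uniq_perm; rewrite ?filter_uniq ?divisors_uniq // => d.
  rewrite !mem_filter -!dvdn_divisors //.
  case pNd : (p %| d)%N => //=.
  by rewrite dvdn_divRL // Gauss_dvd ?p_n ?andbT // coprime_sym prime_coprime ?pNd.
rewrite -[X in _ + X]big_filter -(perm_big _ perm_q) big_filter -big_split /=.
rewrite big_seq_cond big1 // => d /andP[].
rewrite -dvdn_divisors // => d_n pNd.
rewrite moebius_mul_prime ?addNr //.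
exact: dvdn_gt0 d_n.
Qed.

Lemma perm_codivisors (n : nat) : (0 < n)%N ->
  perm_eq (divisors n) [seq (n %/ e)%N | e <- divisors n].
Proof.
move=> n_gt0.
have cod d : d \in divisors n -> (n %/ d)%N \in divisors n.
  by rewrite -!dvdn_divisors // => /dvdn_div.
have codK d : d \in divisors n -> (n %/ (n %/ d))%N = d.
  by rewrite -dvdn_divisors // => d_n; rewrite divnA // mulKn.
apply: uniq_perm; rewrite ?divisors_uniq //.
  by rewrite map_inj_in_uniq ?divisors_uniq // => x y /codK {2}<- /codK {2}<- ->.
move=> d; apply/idP/mapP => [d_n|[e e_n ->]]; last exact: cod.
by exists (n %/ d)%N; rewrite ?cod ?codK.
Qed.

(** The divisors of [gcdn j n] are indexed by their codivisors [e] in [n], so that the weights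
    [moebius (n %/ e)] of the divisor formula for Ramanujan sums appear directly. *)
Lemma coprime_moebius (j n : nat) : (0 < n)%N ->
  (coprime j n)%:R = \sum_(e <- divisors n | (n %/ e %| j)%N) moebius (n %/ e).
Proof.
move=> n_gt0; have g_gt0 : (0 < gcdn j n)%N by rewrite gcdn_gt0 n_gt0 orbT.
rewrite /coprime -sum_moebius_divisors //.
rewrite -(big_map (fun e => n %/ e)%N (fun d => d %| j)%N (fun d => moebius d)).
rewrite -(perm_big _ (perm_codivisors n_gt0)) /= -[RHS]big_filter.
apply: perm_big; apply: uniq_perm; rewrite ?filter_uniq ?divisors_uniq // => d.
by rewrite mem_filter -!dvdn_divisors // dvdn_gcd.
Qed.

Lemma big_multiples (V : nmodType) (d e : nat) (F : nat -> V) : (0 < d)%N ->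
  \sum_(1 <= j < (d * e).+1 | (d %| j)%N) F j =
  \sum_(1 <= i < e.+1) F (d * i)%N.
Proof.
move=> d_gt0; elim: e => [|e IHe]; first by rewrite muln0 !big_geq.
(* The block from [d * e + 1] to [d * e.+1] contains a single multiple of [d], namely its last
   element. *)
rewrite (@big_cat_nat _ _ _ (d * e).+1) //=; last first.
  by rewrite ltnS leq_mul2l leqnSn orbT.
rewrite IHe [RHS]big_nat_recr //=; congr (_ + _).
have lt_de : (d * e < d * e.+1)%N by rewrite ltn_pmul2l.
rewrite big_mkcond big_nat_recr //= dvdn_mulr // big_nat big1 ?add0r // => j.
case/andP=> de_j j_de; case: ifP => // /dvdnP[q def_j]; move: de_j j_de.
by rewrite def_j (mulnC q) !ltn_pmul2l // => e_q; rewrite ltnS leqNgt e_q.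
Qed.

(** * Counting units modulo m in a residue class modulo L *)

Lemma coprime_lift (L m a : nat) : (0 < L)%N -> (0 < m)%N -> coprime a L ->
  exists2 u, coprime u m & u = a %[mod L].
Proof.
(* [M] is the largest divisor of [m] prime to [L]. The Chinese remainder theorem gives a lift of [a]
   that is 1 modulo [M], hence prime to both [L] and [M]. *)
move=> L_gt0 m_gt0 a_L; pose M := (m`_(\pi(L)^'))%N.
have co_LM : coprime L M.
  by rewrite -{1}(part_pnat_id (pnat_pi L_gt0)) coprime_partC.
exists (chinese L M a 1); last exact: chinese_modl.
have u_L : coprime (chinese L M a 1) L.
  by rewrite -coprime_modl chinese_modl // coprime_modl.
have u_M : coprime (chinese L M a 1) M.
  by rewrite -coprime_modl chinese_modr // coprime_modl coprime1n.
(* What remains is the part of [m] supported on primes of [L]: a prime that it shares with the lift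
   would divide [L], to which the lift is prime. *)
rewrite -(partnC \pi(L) m_gt0) coprimeMr u_M andbT.
apply: contraT => not_co; set g := gcdn (chinese L M a 1) (m`_\pi(L))%N.
have g_gt1 : (1 < g)%N.
  by rewrite ltn_neqAle eq_sym not_co gcdn_gt0 part_gt0 orbT.
have [p_u p_m] : (pdiv g %| chinese L M a 1)%N /\ (pdiv g %| m`_\pi(L))%N.
  by split; apply: dvdn_trans (pdiv_dvd g) _; rewrite ?dvdn_gcdl ?dvdn_gcdr.
have : pdiv g \in \pi(L).
  apply: pnatPpi (part_pnat _ m) _.
  by rewrite mem_primes pdiv_prime ?part_gt0.
rewrite mem_primes => /and3P[p_pr _ p_L].
by have := coprime_dvdl p_u u_L; rewrite prime_coprime // p_L.
Qed.

Lemma eqn_mod_mul2l (u d x y : nat) : coprime u d ->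
  (u * x == u * y %[mod d]) = (x == y %[mod d]).
Proof.
move=> u_d; wlog le_yx : x y / (y <= x)%N.
  by have [?|/ltnW ?] := leqP y x; last rewrite eq_sym [RHS]eq_sym; apply.
by rewrite !eqn_mod_dvd ?leq_mul // -mulnBr Gauss_dvdr // coprime_sym.
Qed.

Lemma sum_coprime_residue (L m : nat) : (0 < m)%N -> (L %| m)%N ->
  ((\sum_(k < m | coprime k m) (k == 1 %[mod L])) * totient L = totient m)%N.
Proof.
move=> m_gt0 L_m; have L_gt0 := dvdn_gt0 m_gt0 L_m.
pose N a := (\sum_(k < m | coprime k m) (k == a %[mod L]))%N.
(* [N a] is the size of the fibre over [a]. Multiplication by a unit [u] over [a] permutes the
   residues modulo [m] and carries the fibre over 1 onto the fibre over [a]. *)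
have N_const a : coprime a L -> N a = N 1%N.
  move=> /(coprime_lift L_gt0 m_gt0)[u u_m u_a].
  have u_L : coprime u L by apply: coprime_dvdr u_m.
  pose h (k : 'I_m) : 'I_m := Ordinal (ltn_pmod (u * k) m_gt0).
  have h_inj : injective h.
    move=> k l /(congr1 val) /= /eqP; rewrite eqn_mod_mul2l //.
    by rewrite !modn_small // => /eqP/val_inj.
  rewrite /N (reindex_inj h_inj) /=; apply: eq_big => [k|k _].
    by rewrite coprime_modl coprimeMl u_m.
  by rewrite modn_dvdm // -u_a -{2}[u]muln1 eqn_mod_mul2l.
rewrite -/(N 1%N) totient_count_coprime [RHS]totient_count_coprime !big_mkord.
rewrite big_distrr /=.
(* Double counting of pairs: for each unit [a] modulo [L], one copy of [N 1] is replaced by [N a];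
   after the exchange, each unit [k] modulo [m] is counted once, at [a = k %% L]. *)
transitivity (\sum_(a < L) \sum_(k < m | coprime k m)
    coprime L a * (k == a %[mod L]))%N.
  apply: eq_bigr => a _; case co : (coprime L a); rewrite ?muln0 ?muln1.
    by rewrite -(N_const a) 1?coprime_sym //; apply: eq_bigr => k _; rewrite mul1n.
  by rewrite big1.
rewrite exchange_big /= [RHS]big_mkcond /= big_mkcond /=; apply: eq_bigr => k _.
rewrite coprime_sym; case: ifP => // co_km.
rewrite (bigD1 (Ordinal (ltn_pmod k L_gt0))) //= modn_mod eqxx muln1.
rewrite coprime_modr (coprime_dvdl L_m) // big1 // => a ne_a.
have [eq_a|] := eqVneq (k %% L)%N (a %% L)%N; last by rewrite muln0.
by case/eqP: ne_a; apply: val_inj; rewrite /= eq_a modn_small.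
Qed.

(** * Roots of unity and the divisor formula for Ramanujan sums *)

Local Notation twopii R := (2 * (@pi R)%:C%C * 'i%C).

Lemma cexpD (R : realType) (z w : R[i]) : cexp (z + w) = cexp z * cexp w.
Proof.
case: z w => [a b] [c d]; rewrite /cexp /= expRD cosD sinD rmorphM /= mulrACA.
by congr (_ * _); apply/eqP; rewrite eq_complex /= eqxx addrC eqxx.
Qed.

Lemma cexp0 (R : realType) : cexp (0 : R[i]) = 1.
Proof. by rewrite /cexp /= expR0 cos0 sin0 mul1r. Qed.

Lemma cexpMn (R : realType) (z : R[i]) (n : nat) : cexp (z *+ n) = cexp z ^+ n.
Proof. by elim: n => [|n IHn]; rewrite ?cexp0 // mulrS cexpD IHn exprS. Qed.

Lemma cexp_imaginary (R : realType) (x : R) :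
  cexp (x%:C * 'i)%C = (cos x +i* sin x)%C.
Proof. by rewrite /cexp; simpc; rewrite /= expR0 !mul1r. Qed.

Lemma cexp_2piiMz (R : realType) (k : int) : cexp (twopii R *~ k) = 1.
Proof.
have cexp_2pii : cexp (twopii R) = 1.
  have -> : twopii R = (pi *+ 2)%:C%C * 'i%C.
    by rewrite -[in RHS]mulr_natl rmorphM rmorph_nat.
  by rewrite cexp_imaginary cos2pi sin2pi.
case: k => n; rewrite ?NegzE ?mulrNz -!pmulrn.
  by rewrite cexpMn cexp_2pii expr1n.
have := cexpD (- (twopii R *+ n.+1)) (twopii R *+ n.+1).
by rewrite addNr cexp0 cexpMn cexp_2pii expr1n mulr1.
Qed.

(** By periodicity [k] may be replaced by its remainder [r] modulo [n]. If the value is 1, then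
    cos(2x) = 1 for x = pi r / n, so sin x = 0; but for 0 < r < n the angle x lies strictly between
    0 and pi, where the sine is positive. *)
Lemma cexp_root_of_unity_eq1 (R : realType) (n : nat) (k : int) : (0 < n)%N ->
  (cexp (twopii R * k%:~R / n%:R) == 1) = (n%:Z %| k)%Z.
Proof.
move=> n_gt0; have n_neq0 : (n%:R : R[i]) != 0 by rewrite pnatr_eq0 -lt0n.
have -> : cexp (twopii R * k%:~R / n%:R) = cexp (twopii R * (k %% n)%Z%:~R / n%:R).
  rewrite {1}(divz_eq k n) intrD intrM mulrDr mulrDl cexpD.
  by rewrite (mulrA (twopii R)) mulfK // mulrzr cexp_2piiMz mul1r.
rewrite (sameP dvdz_mod0P eqP).
have := modz_ge0 k (_ : n%:Z != 0); rewrite eqz_nat -lt0n => /(_ n_gt0).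
have := ltz_pmod k (_ : 0 < n%:Z); rewrite ltz_nat => /(_ n_gt0).
case: (k %% n)%Z => // r; rewrite ltz_nat eqz_nat => r_n _.
have -> : twopii R * r%:~R / n%:R = ((pi * (r%:R / n%:R)) *+ 2)%:C%C * 'i%C.
  rewrite -[in RHS]mulr_natl !rmorphM fmorphV !rmorph_nat -pmulrn /=.
  by rewrite -!mulrA; do 2!congr (_ * _); rewrite mulrC -mulrA.
rewrite cexp_imaginary; have [->|r_neq0] := eqVneq r 0%N.
  by rewrite mul0r mulr0 mul0rn cos0 sin0 eqxx.
rewrite eq_complex /=; apply/negP => /andP[/eqP c1 _].
have : 0 < sin (pi * (r%:R / n%:R) : R).
  apply: sin_gt0_pi; rewrite mulr_gt0 ?pi_gt0 ?divr_gt0 ?ltr0n ?(lt0n r) //=.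
  by rewrite gtr_pMr ?pi_gt0 // ltr_pdivrMr ?ltr0n // mul1r ltr_nat.
move/eqP: c1; rewrite cos_mulr2n subr_eq -mulr2n -subr_eq0 -mulrnBl mulrn_eq0.
rewrite /= -oppr_eq0 opprB -sin2cos2 sqrf_eq0 => /eqP ->.
by rewrite ltxx.
Qed.

Lemma sum_cexp (R : realType) (n : nat) (k : int) : (0 < n)%N ->
  \sum_(1 <= j < n.+1) cexp (twopii R * j%:R * k%:~R / n%:R) =
  n%:R * (n%:Z %| k)%Z%:R.
Proof.
move=> n_gt0; have n_neq0 : (n%:R : R[i]) != 0 by rewrite pnatr_eq0 -lt0n.
set w := cexp (twopii R * k%:~R / n%:R).
have wE j : cexp (twopii R * j%:R * k%:~R / n%:R) = w ^+ j.
  by rewrite -cexpMn !(mulrAC _ j%:R) mulr_natr.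
have wn1 : w ^+ n = 1 by rewrite -wE mulrAC mulfK // mulrzr cexp_2piiMz.
rewrite (eq_bigr _ (fun j _ => wE j)) -(cexp_root_of_unity_eq1 R k n_gt0) -/w.
(* Taking out one factor [w] shifts the exponents from 1..n to 0..n-1, the range of the geometric
   sum in [subrX1]. *)
rewrite big_add1 big_mkord; under eq_bigr do rewrite exprS; rewrite -mulr_sumr.
have [->|w_neq1] := eqVneq w 1.
  under eq_bigr do rewrite expr1n; rewrite sumr_const card_ord mul1r mulr1 //.
apply/eqP; rewrite mulr0 mulf_eq0; apply/orP; right.
have /eqP := subrX1 w n; rewrite wn1 subrr eq_sym mulf_eq0 subr_eq0.
by rewrite (negPf w_neq1).
Qed.


(** Once the sums are exchanged, the divisor [e] selects the indices [j = (n %/ e) * i] with [i]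
    from 1 to [e]. The factor [n %/ e] cancels in the exponent, which leaves a complete sum of
    [e]-th roots of unity. *)
Lemma ramanujan_sum_divisors (R : realType) (n : nat) (k : int) : (0 < n)%N ->
  ramanujan_sum R n k =
  \sum_(e <- divisors n) e%:R * (moebius (n %/ e))%:~R * (e%:Z %| k)%Z%:R.
Proof.
move=> n_gt0; rewrite /ramanujan_sum big_mkcond /=.
pose f j : R[i] := cexp (twopii R * j%:R * k%:~R / n%:R).
transitivity (\sum_(1 <= j < n.+1) \sum_(e <- divisors n)
    if (n %/ e %| j)%N then (moebius (n %/ e))%:~R * f j else 0).
  apply: eq_bigr => j _; rewrite -big_mkcond -mulr_suml -rmorph_sum /=.
  by rewrite -coprime_moebius //; case: coprime; rewrite ?mul1r ?mul0r.
rewrite exchange_big; apply: eq_big_seq => e; rewrite -dvdn_divisors // => e_n.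
have e_gt0 := dvdn_gt0 n_gt0 e_n.
have d_gt0 : (0 < n %/ e)%N by rewrite divn_gt0 // dvdn_leq.
have := big_multiples e f d_gt0; rewrite divnK // => sumE.
rewrite -big_mkcond -mulr_sumr sumE.
rewrite mulrAC -sum_cexp // mulrC; congr (_ * _).
apply: eq_bigr => j _; congr cexp.
have nE : (n%:R : R[i]) = (n %/ e)%:R * e%:R by rewrite -natrM divnK.
have d_neq0 : ((n %/ e)%:R : R[i]) != 0 by rewrite pnatr_eq0 -lt0n.
by rewrite nE natrM (mulrCA (twopii R)) -(mulrA _ _ k%:~R) -mulf_div divff // mul1r.
Qed.

(** * Divisor tuples, their lcm, and the final identity *)

Lemma sum_coprime_1_mod (L m : nat) : (0 < m)%N -> (L %| m)%N ->
  ((\sum_(1 <= k < m.+1 | coprime k m) (k == 1 %[mod L])) * totient L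
    = totient m)%N.
Proof.
move=> m_gt0 L_m; rewrite -(sum_coprime_residue m_gt0 L_m); congr (_ * _)%N.
rewrite -(big_mkord (fun k => coprime k m) (fun k => (k == 1 %[mod L]) : nat)).
(* The ranges 1..m and 0..m-1 differ only in the terms at [m] and at 0. These agree: both have gcd
   [m] with [m], and both are 0 modulo [L] because [L] divides [m]. *)
rewrite big_mkcond [RHS]big_mkcond [LHS]big_nat_recr //= [RHS]big_ltn //= addnC.
rewrite /coprime gcdnn gcd0n mod0n.
by rewrite (eqP (L_m : (m %% L == 0)%N)).
Qed.

(** The bound [M] may exceed [n], so the divisors of all the [m i] can share one index type;
    distributing the product over functions requires this. *)
Lemma big_divisors_ord (V : nmodType) (n M : nat) (F : nat -> V) :
  (0 < n <= M)%N ->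
  \sum_(e <- divisors n) F e = \sum_(d < M.+1 | (d %| n)%N) F d.
Proof.
case/andP=> n_gt0 n_M; rewrite -(big_mkord (fun d => d %| n)%N F) -[RHS]big_filter.
apply: perm_big; apply: uniq_perm.
- exact: divisors_uniq.
- by rewrite filter_uniq ?iota_uniq.
move=> d; rewrite mem_filter -dvdn_divisors // mem_index_iota /= ltnS.
by case d_n : (d %| n)%N => //=; rewrite (leq_trans _ n_M) // dvdn_leq.
Qed.

Lemma lcm_family_gt0 (r : nat) (m : 'I_r -> nat) :
  (forall i, (0 < m i)%N) -> (0 < lcm_family m)%N.
Proof.
move=> m_gt0; rewrite /lcm_family; elim/big_ind: _ => // x y x_gt0 y_gt0.
by rewrite lcmn_gt0 x_gt0.
Qed.

Lemma dvdn_lcm_family (r : nat) (m : 'I_r -> nat) (i : 'I_r) :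
  (m i %| lcm_family m)%N.
Proof. exact: (biglcmn_sup i). Qed.

Lemma lcm_family_dvdP (r : nat) (m : 'I_r -> nat) (n : nat) :
  reflect (forall i, (m i %| n)%N) (lcm_family m %| n)%N.
Proof. by apply: (iffP (dvdn_biglcmP _ _ _)) => h i //; apply: h. Qed.

Theorem corollary12 (R : realType) (r : nat) (hr : (0 < r)%N)
    (m : 'I_r -> nat) (hm : forall i, (0 < m i)%N) :
  ramanujan_R R m =
    (totient (lcm_family m))%:R *
    \sum_(d : {ffun 'I_r -> 'I_(lcm_family m).+1} | divisor_tuple d)
      (\prod_(i < r) ((d i)%:R * (moebius (m i %/ d i))%:~R))
        / (totient (lcm_family (fun i => d i)))%:R.
Proof.
have M_gt0 := lcm_family_gt0 hm; set M := lcm_family m in M_gt0 *.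
have m_M i : (0 < m i <= M)%N.
  by rewrite hm dvdn_leq // dvdn_lcm_family.
pose F (d : {ffun 'I_r -> 'I_M.+1}) : R[i] :=
  \prod_(i < r) ((d i)%:R * (moebius (m i %/ d i))%:~R).
pose L (d : {ffun 'I_r -> 'I_M.+1}) := lcm_family (fun i => d i).
(* Positivity of [k] makes the integer [k%:Z - 1] a natural number, as in the divisibilities by
   [d i] below. *)
have expand k : (0 < k)%N -> \prod_(i < r) ramanujan_sum R (m i) (k%:Z - 1) =
    \sum_(d : {ffun 'I_r -> 'I_M.+1} | divisor_tuple d)
      F d * (k == 1 %[mod L d])%:R.
  move=> k_gt0; under eq_bigr => i _.
    rewrite ramanujan_sum_divisors // (big_divisors_ord _ (m_M i)).
    over.
  rewrite bigA_distr_big_dep; apply: eq_big => [d|d _].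
    by apply/familyP/forallP.
  rewrite big_split /= -/(F d) -natr_prod; congr (_ * _%:R).
  (* The product of the indicators of [d i %| k - 1] is the indicator of divisibility by their lcm
     [L d]. *)
  rewrite eqn_mod_dvd // subzn //.
  case: lcm_family_dvdP => [dv|ndv].
    by rewrite big1 // => i _; rewrite dvdzE /= dv.
  have /forallPn[i ndi] : ~~ [forall i, (d i %| k - 1)%N] by apply/forallP.
  by rewrite (bigD1 i) //= dvdzE /= (negPf ndi).
(* [big_nat_cond] exposes the bound [0 < k] that [expand] requires. *)
rewrite /ramanujan_R -/M big_nat_cond.
under eq_bigr => k /andP[/andP[k_gt0 _] _] do rewrite expand //.
rewrite -big_nat_cond exchange_big mulr_sumr; apply: eq_bigr => d /forallP d_m.
have L_M : (L d %| M)%N.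
  by apply/lcm_family_dvdP => i; apply: dvdn_trans (d_m i) (dvdn_lcm_family m i).
have phi_neq0 : ((totient (L d))%:R : R[i]) != 0.
  by rewrite pnatr_eq0 -lt0n totient_gt0 (dvdn_gt0 M_gt0).
(* The count of [k] for the tuple [d], times the totient of [L d], is the totient of [M]; the
   totient of [L d] then cancels. *)
rewrite -mulr_sumr -natr_sum -(sum_coprime_1_mod M_gt0 L_M) natrM -/(F d).
by rewrite [RHS]mulrACA divff // mulr1 mulrC.
Qed.
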